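(* Let $(X,d,\mu)$ be a metric measure space, fix $1<p<\infty$, and set $q=p/(p-1)$. Let $\{B^{cl}(x_n,r_n)\}_{1\le n\le N}$ be a sequence of closed balls with centers in the support of $\mu$. If $\|M_\mu\|_{L^q(\mu)\to L^q(\mu)}<\infty$, then there exists a numerical sequence $\{T_n\}_{1\le n\le N}$ with $0<T_n<1$, depending on $\{B^{cl}(x_n,r_n)\}_{1\le n\le N}$, such that whenever $0<t_n\le T_n$ for $1\le n\le N$, for every sequence of weights $\{w_n\}_{1\le n\le N}$ ($w_n>0$) we have $$ \left\| \sum_{1 \le n \le N}\frac{w_n \mathbf{1}_{B^{cl} (x_{n}, r_{n})} }{\mu B^{cl}(x_{n}, r_{n})} \right\|_{L^p(\mu)} \le 2 \left\|M_{\mu} \right\|_{L^q (\mu) \to L^q (\mu)} \left\| \sum_{1 \le n \le N}\frac{w_n \mathbf{1}_{B^{cl}(x_{n}, t_n r_{n})} }{\mu B^{cl} (x_{n}, t_n r_{n})} \right\|_{L^p(\mu)}. $$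
   Context: A Borel measure $\mu$ on a metric space $(X,d)$ is $\tau$-additive if for every collection $\{U_\alpha\}_{\alpha\in\Lambda}$ of open sets, $\mu(\cup_\alpha U_\alpha)=\sup \mu(\cup_{i=1}^n U_{\alpha_i})$, the supremum being over all finite subcollections. A metric measure space $(X,d,\mu)$ is a metric space with a $\tau$-additive Borel measure $\mu$, not identically zero, that is finite on bounded Borel sets. $B(x,r)=\{y: d(x,y)<r\}$ and $B^{cl}(x,r)=\{y: d(x,y)\le r\}$; radii are always $>0$. The support of $\mu$ is the complement of $\cup\{B(x,r): x\in X,\ r>0,\ \mu B(x,r)=0\}$. The centered Hardy-Littlewood maximal operator is, for $g$ locally integrable, $$M_{\mu} g(x) := \sup _{\{r >0 : \ 0 < \mu (B^{cl}(x, r))\}} \frac{1}{\mu (B^{cl}(x, r))} \int _{B^{cl}(x, r)} |g|\, d\mu.$$ $\|M_\mu\|_{L^q(\mu)\to L^q(\mu)}$ is the smallest $c\in[0,\infty]$ with $\|M_\mu g\|_{L^q(\mu)}\le c\|g\|_{L^q(\mu)}$ for all $g\in L^q(\mu)$. *)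

(* Defs.v *)
From HB Require Import structures.
From mathcomp Require Import all_boot all_order all_algebra.
From mathcomp Require Import all_classical all_reals all_analysis.

Set Implicit Arguments.
Unset Strict Implicit.
Unset Printing Implicit Defensive.

Import Order.TTheory GRing.Theory Num.Theory.
Import numFieldNormedType.Exports.

Local Open Scope classical_set_scope.
Local Open Scope ring_scope.
Local Open Scope ereal_scope.

(* The measurable types of the library are pointed. The point loses no
   generality: a space with a nonzero measure is nonempty. *)
#[short(type="pmetricType")]
HB.structure Definition PointedMetric (K : numDomainType) :=
  { M of Pointed M & Metric K M }.

Definition borelType (R : realType) (X : pmetricType R) :=
  g_sigma_algebraType (@open X).

(* Not the library's [closed_ball], which is the closure of the open ball. *)
Definition cball (R : realType) (X : pmetricType R) (x : X) (r : R) : set X :=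
  [set y | (mdist x y <= r)%R].

Definition metric_bounded (R : realType) (X : pmetricType R) (A : set X) :=
  exists x : X, exists r : R, A `<=` ball x r.

Section metric_measure.
Context (R : realType) (X : pmetricType R).
Variable mu : {measure set (borelType X) -> \bar R}.

Definition tau_additive :=
  forall (L : Type) (U : L -> set X), (forall a, open (U a)) ->
    mu (\bigcup_a U a) =
    ereal_sup [set mu (\bigcup_(a in F) U a) | F in [set F | finite_set F]].

Definition metric_measure :=
  [/\ tau_additive,
      exists2 A : set (borelType X), measurable A & mu A != 0 &
      forall A : set (borelType X),
        measurable A -> @metric_bounded R X A -> mu A < +oo].

Definition msupport : set X :=
  ~` \bigcup_(B in [set B : set X | exists x : X, exists2 r : R,
        (0 < r)%R & B = ball x r /\ mu B = 0]) B.

Definition centered_maximal (g : borelType X -> R) (x : borelType X) : \bar R :=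
  ereal_sup [set (mu (cball x r))^-1 * \int[mu]_(y in cball x r) `|(g y)%:E|
            | r in [set r : R | (0 < r)%R /\ 0 < mu (cball x r)]].

(* For [0 < q] the infimum is a minimum: each condition on [c] is closed, and
   [+oo] meets it, since [+oo * 0 = 0] and [centered_maximal g] vanishes when
   [g = 0] almost everywhere. *)
Definition maximal_norm (q : R) : \bar R :=
  ereal_inf [set c : \bar R | 0 <= c /\
    forall g : borelType X -> R, g \in Lfun mu q%:E ->
      'N[mu]_q%:E[centered_maximal g] <= c * 'N[mu]_q%:E[EFin \o g]].

End metric_measure.

(* Main.v *)
Require Import Defs.
From mathcomp Require Import all_boot all_order all_algebra.
From mathcomp Require Import all_classical all_reals all_analysis.
From mathcomp Require Import measurable_realfun measurable_fun_approximation.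
From mathcomp Require Import ring lra.

(** The large balls [B_n = cball (x n) (r n)] are compared with the small balls
    [b_n = cball (x n) (t n * r n)] by duality. Write [F] and [G] for the two
    sums of normalized indicators and let [g = F `^ (p - 1)], the function
    extremal for Hoelder's inequality against [F]. Then [\int F * g] is the sum
    of the [w n] times the averages of [g] over [B_n].

    The maximal function sees these averages from every point of [b_n]: for
    [y] in [b_n] the ball of radius [(1 + t n) * r n] about [y] contains [B_n]
    and is contained in [cball (x n) ((1 + 2 * t n) * r n)]. By continuity of
    [mu] from above, the latter has measure at most [2 * mu B_n] as soon as
    [t n] is below some [T n], which depends on the ball only. Hence half the
    average of [g] over [B_n] is a lower bound [c n] of the maximal function on
    the whole of [b_n] ([centered_maximal_ge]).

    The summand of [G] carried by [b_n] has integral [w n], so the sum of the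
    [w n * c n] is at most [\int G * h] for any [h] that dominates [c n] on [b_n], and
    Hoelder's inequality bounds this by the product of the norms of [h] and
    [G] ([weighted_sum_le_Lnorm]). Altogether [\int F * g] is at most
    [2 * maximal_norm * 'N_q[g] * 'N_p[G]], and since [\int F * g] equals
    ['N_p[F] * 'N_q[g]] the factor ['N_q[g]] cancels ([Lnorm_le_dual]).

    Hoelder's inequality asks for measurable functions, so it is applied to the
    simple function [h] that is the maximum of the [c n] over the small balls
    containing the point. From [h] one passes to the maximal function by
    monotonicity of the integral, which holds for arbitrary functions because
    the integral is a supremum over simple ones ([le_Lnorm]). *)

Set Implicit Arguments.
Unset Strict Implicit.

Import Order.TTheory GRing.Theory Num.Theory.
Import numFieldNormedType.Exports.

Local Open Scope classical_set_scope.
Local Open Scope ring_scope.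
Local Open Scope ereal_scope.

(** * Norms, duality and monotonicity *)

(** The integral of a nonnegative function is a supremum over the simple
    functions below it, so it is monotone on all functions, measurable or not.
    This allows the maximal function in the role of [g]. *)
Lemma le_Lnorm d (T : measurableType d) (R : realType)
    (mu : {measure set T -> \bar R}) (p : R) (f g : T -> \bar R) :
  (0 < p)%R -> (forall x, `|f x| <= `|g x|) -> 'N[mu]_p%:E[f] <= 'N[mu]_p%:E[g].
Proof.
move=> p0 fg; rewrite unlock /Lnorm.
have ipos (h : T -> \bar R) : \int[mu]_x `|h x| `^ p \in `[0, +oo].
  by rewrite in_itv/= leey andbT integral_ge0// => x _; exact: poweR_ge0.
apply: gt0_ler_poweR => //; first by rewrite invr_ge0 ltW.
rewrite !ge0_integralTE; [|by move=> x; exact: poweR_ge0..].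
apply: le_ereal_sup => _ [h hf <-]; exists h => // x.
apply: (le_trans (hf x)).
by apply: gt0_ler_poweR; rewrite ?(ltW p0) ?in_itv/= ?abse_ge0 ?leey.
Qed.

(** Since [(p - 1) * q = p], both norms are powers of one integral, that of
    [f `^ p]. *)
Lemma Lnorm_powR_conj d (T : measurableType d) (R : realType)
    (mu : {measure set T -> \bar R}) (p q : R) (f : T -> R) :
  (1 < p)%R -> (q = p / (p - 1))%R -> (forall x, 0 <= f x)%R ->
  'N[mu]_q%:E[EFin \o (fun x => f x `^ (p - 1))%R]
    = 'N[mu]_p%:E[EFin \o f] `^ (p - 1).
Proof.
move=> p1 -> f0; rewrite unlock /Lnorm.
have p10 : (p - 1 != 0)%R by lra.
rewrite -poweRrM invf_div [(p^-1 * _)%R]mulrC; congr (_ `^ _).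
apply: eq_integral => x _ /=.
rewrite ger0_norm ?powR_ge0// ger0_norm// -powRrM.
by congr ((_ `^ _)%:E)%R; field.
Qed.

(** Converse of Hoelder's inequality, tested on the extremal function [g] only:
    [\int f * g = 'N_p[f] `^ p] is the product of ['N_p[f]] and
    ['N_q[g] = 'N_p[f] `^ (p - 1)], which is finite and cancels unless
    ['N_p[f] = 0]. *)
Lemma Lnorm_le_dual d (T : measurableType d) (R : realType)
    (mu : {measure set T -> \bar R}) (p q : R) (f : T -> R) (K : \bar R) :
  (1 < p)%R -> (q = p / (p - 1))%R -> (forall x, 0 <= f x)%R ->
  f \in Lfun mu p%:E -> 0 <= K ->
  (let g := (fun x => f x `^ (p - 1))%R in
    0 < 'N[mu]_q%:E[EFin \o g] ->
   \int[mu]_x (f x * g x)%:E <= K * 'N[mu]_q%:E[EFin \o g]) ->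
  'N[mu]_p%:E[EFin \o f] <= K.
Proof.
move=> p1 qE f0 fL K0 /=; rewrite (Lnorm_powR_conj _ p1 qE f0).
have p0 : (0 < p)%R by lra.
have -> : \int[mu]_x (f x * f x `^ (p - 1))%:E = 'N[mu]_p%:E[EFin \o f] `^ p.
  rewrite poweR_Lnorm ?gt_eqF//; apply: eq_integral => x _ /=.
  by rewrite mulr_powRB1// ger0_norm.
have : 'N[mu]_p%:E[EFin \o f] < +oo.
  by move: fL; rewrite inE => /andP[_ /[!inE]].
have := Lnorm_ge0 mu p%:E (EFin \o f).
case: ('N[mu]_p%:E[EFin \o f]) => [u||]//=; rewrite lee_fin le_eqVlt.
case/predU1P => [<- _ _|u0 _]; first by [].
rewrite -(mulr_powRB1 (ltW u0) p0) EFinM lte_fin powR_gt0// => /(_ isT).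
by rewrite lee_pmul2r// lte_fin powR_gt0.
Qed.

Lemma Lfun_powR_conj d (T : measurableType d) (R : realType)
    (mu : {measure set T -> \bar R}) (p q : R) (f : T -> R) :
  (1 < p)%R -> (q = p / (p - 1))%R -> (forall x, 0 <= f x)%R ->
  f \in Lfun mu p%:E -> (fun x => f x `^ (p - 1))%R \in Lfun mu q%:E.
Proof.
move=> p1 qE f0; rewrite !inE => /andP[/[!inE]/= mf Nf].
apply/andP; split; rewrite inE/=.
  exact: (@measurableT_comp _ _ _ _ _ _ (@powR R ^~ (p - 1)%R)).
by rewrite /finite_norm (Lnorm_powR_conj _ p1 qE f0) poweR_lty.
Qed.

Lemma bounded_integral_lty d (T : measurableType d) (R : realType)
    (mu : {measure set T -> \bar R}) (B : set T) (g : T -> R) (C : R) :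
  measurable B -> mu B < +oo -> measurable_fun setT g ->
  (forall x, 0 <= g x <= C)%R -> \int[mu]_(x in B) (g x)%:E < +oo.
Proof.
move=> mB Boo mg gC.
apply: (@le_lt_trans _ _ (\int[mu]_(x in B) C%:E)).
  apply: ge0_le_integral => //.
  - by move=> x _; rewrite lee_fin; case/andP: (gC x).
  - by apply: measurable_funTS; apply/measurable_EFinP.
  - by move=> x _; rewrite lee_fin; case/andP: (gC x).
rewrite integral_cst// lte_mul_pinfty// lee_fin.
by case/andP: (gC point) => /le_trans; apply.
Qed.

(** * Sums of normalized indicators *)

(** Real-valued so that [Lfun] and [hoelder] apply; for sets of positive finite
    measure it is the extended real quotient ([normalized_sumE]). *)
Definition normalized_sum {d} {T : measurableType d} {R : realType}
    (mu : {measure set T -> \bar R}) {N} (w : 'I_N -> R) (B : 'I_N -> set T)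
    (y : T) : R :=
  (\sum_(n < N) w n / fine (mu (B n)) * \1_(B n) y)%R.

Section normalized_sum.
Context d (T : measurableType d) (R : realType).
Variables (mu : {measure set T -> \bar R}) (N : nat).
Variables (w : 'I_N -> R) (B : 'I_N -> set T).
Hypothesis w0 : forall n, (0 <= w n)%R.
Hypothesis mB : forall n, measurable (B n).
Hypothesis B0 : forall n, 0 < mu (B n) < +oo.

Let fB0 n : (0 < fine (mu (B n)))%R.
Proof. by apply: fine_gt0. Qed.

Let finB n : mu (B n) = (fine (mu (B n)))%:E.
Proof.
by rewrite fineK// ge0_fin_numE ?measure_ge0//; case/andP: (B0 n).
Qed.

Lemma normalized_sum_ge0 y : (0 <= normalized_sum mu w B y)%R.
Proof.
apply: sumr_ge0 => n _; apply: mulr_ge0 => //.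
by rewrite divr_ge0// ltW.
Qed.

Lemma normalized_sumE y : (normalized_sum mu w B y)%:E =
  \sum_(n < N) (w n * \1_(B n) y)%:E / mu (B n).
Proof.
rewrite /normalized_sum -sumEFin; apply: eq_bigr => n _.
by rewrite [in RHS]finB inver gt_eqF// -EFinM mulrAC.
Qed.

Lemma measurable_normalized_sum :
  measurable_fun setT (normalized_sum mu w B).
Proof.
by apply: measurable_sum => n; apply: measurable_funM.
Qed.

Lemma Lfun_normalized_sum (p : R) : (1 <= p)%R ->
  normalized_sum mu w B \in Lfun mu p%:E.
Proof.
move=> p1; have p1E : 1 <= p%:E by [].
have -> : normalized_sum mu w B =
    (\sum_(n < N) (w n / fine (mu (B n)) \o* \1_(B n)))%R.
  by apply/funext => y; rewrite fct_sumE; apply: eq_bigr => n _; rewrite /= mulrC.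
have [L0 LD] := @Lfun_addr_closed _ T R mu p%:E p1E.
apply: (big_ind (fun f => f \in Lfun mu p%:E)) => // n _.
apply: Lfun_scale => //; rewrite inE; apply/andP; split; rewrite inE/=.
  exact: measurable_indic.
rewrite /finite_norm unlock /Lnorm; apply: poweR_lty.
rewrite (eq_integral (fun x => (\1_(B n) x)%:E)).
  by rewrite integral_indic// setIT; case/andP: (B0 n).
move=> x _ /=; rewrite indicE; case: (x \in B n) => /=.
  by rewrite normr1 powR1.
by rewrite normr0 powR0//; lra.
Qed.

Lemma integral_normalized_sum (g : T -> R) :
  measurable_fun setT g -> (forall x, 0 <= g x)%R ->
  \int[mu]_x (normalized_sum mu w B x * g x)%:E =
  \sum_(n < N) (w n)%:E * ((mu (B n))^-1 * \int[mu]_(x in B n) (g x)%:E).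
Proof.
move=> mg g0.
under eq_integral do rewrite /normalized_sum mulr_suml -sumEFin.
rewrite ge0_integral_sum//; last 2 first.
- move=> n; apply/measurable_EFinP; apply: measurable_funM => //.
  by apply: measurable_funM => //; exact: measurable_indic.
- move=> n x _; rewrite lee_fin; do 2 apply: mulr_ge0 => //.
  by rewrite divr_ge0// ltW.
apply: eq_bigr => n _.
rewrite (eq_integral (fun x => (w n / fine (mu (B n)))%:E *
    (((EFin \o g) \_ (B n)) x))); last first.
  move=> x _; rewrite patchE indicE; case: ifPn => xB /=.
    by rewrite mulr1 EFinM.
  by rewrite !mulr0 mul0r mule0.
rewrite ge0_integralZl_EFin//.
- by rewrite -integral_mkcond EFinM muleA [in RHS]finB inver gt_eqF.
- by move=> x _; rewrite patchE; case: ifPn => // _; rewrite lee_fin.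
- apply/(measurable_restrictT _ (mB n)).1.
  by apply: measurable_funTS; apply/measurable_EFinP.
- by rewrite divr_ge0// ltW.
Qed.

(** Each [c n] is at most the average over [B n] of a function dominating
    [c n] there, and the weighted sum of these averages is an integral against
    [normalized_sum mu w B]. As [M] may fail to be measurable, the dominating
    function is the least one, the maximum [h] of the [c n * \1_(B n)]. *)
Lemma weighted_sum_le_Lnorm (p q : R) (c : 'I_N -> R) (M : T -> \bar R) :
  (1 < p)%R -> (q = p / (p - 1))%R -> (forall n, 0 <= c n)%R ->
  (forall n x, B n x -> (c n)%:E <= M x) ->
  (\sum_(n < N) w n * c n)%:E <=
    'N[mu]_q%:E[M] * 'N[mu]_p%:E[EFin \o normalized_sum mu w B].
Proof.
move=> p1 qE c0 cM.
have q0 : (0 < q)%R by rewrite qE divr_gt0; lra.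
pose h x := (\big[Order.max/0]_(n < N) (c n * \1_(B n) x))%R.
have h0 x : (0 <= h x)%R by apply: bigmax_ge_id.
have mh : measurable_fun setT h.
  rewrite /h; elim: (index_enum _) => [|n s IH].
    rewrite (_ : (fun x => _) = cst 0%R) //.
    by apply/funext => x; rewrite big_nil.
  rewrite (_ : (fun x => _) = (fun x => Num.max (c n * \1_(B n) x)
      (\big[Order.max/0]_(n <- s) (c n * \1_(B n) x)))%R); last first.
    by apply/funext => x; rewrite big_cons.
  by apply: measurable_maxr => //; apply: measurable_funM.
have ch n x : B n x -> (c n <= h x)%R.
  move=> Bx; apply: le_trans (le_bigmax _ (fun n => c n * \1_(B n) x)%R n).
  by rewrite indicE mem_set// mulr1.
have hM x : `|(EFin \o h) x| <= `|M x|.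
  rewrite /= ger0_norm// /h; elim/big_ind: _ => [|u v uM vM|n _].
  - exact: abse_ge0.
  - by rewrite /Order.max; case: ifPn.
  - rewrite indicE; have [Bx|_] := boolP (x \in B n).
      by rewrite mulr1 (le_trans (cM n x _) (lee_abs _))// -inE.
    by rewrite mulr0 abse_ge0.
apply: (@le_trans _ _ ('N[mu]_q%:E[EFin \o h] *
    'N[mu]_p%:E[EFin \o normalized_sum mu w B])); last first.
  by apply: lee_wpmul2r; [exact: Lnorm_ge0 | exact: le_Lnorm].
have p0 : (0 < p)%R by lra.
have pq : (p^-1 + q^-1 = 1)%R by rewrite qE; field; lra.
rewrite muleC.
apply: le_trans (hoelder mu measurable_normalized_sum mh p0 q0 pq).
rewrite Lnorm1.
rewrite (eq_integral (fun x => (normalized_sum mu w B x * h x)%:E)); last first.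
  by move=> x _ /=; rewrite ger0_norm// mulr_ge0// normalized_sum_ge0.
rewrite integral_normalized_sum// -sumEFin; apply: lee_sum => n _.
rewrite EFinM; apply: lee_wpmul2l; first by rewrite lee_fin.
rewrite finB inver gt_eqF// muleC lee_pdivlMr// -finB.
rewrite -(integral_cst mu (mB n)); apply: ge0_le_integral => //.
- by move=> x _; rewrite lee_fin.
- by apply: measurable_funTS; exact/measurable_EFinP.
- by move=> x Bx; rewrite lee_fin; exact: ch.
Qed.

End normalized_sum.

Lemma normalized_sum_le d (T : measurableType d) (R : realType)
    (mu : {measure set T -> \bar R}) N (w : 'I_N -> R) (B : 'I_N -> set T) y :
  (forall n, 0 <= w n)%R ->
  (normalized_sum mu w B y <= \sum_(n < N) w n / fine (mu (B n)))%R.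
Proof.
move=> w0; apply: ler_sum => n _; rewrite ler_piMr//.
by rewrite divr_ge0// fine_ge0.
Qed.

(** * Closed balls in a metric measure space *)

Lemma open_ball_metric (R : realType) (X : pmetricType R) (x : X) (r : R) :
  open (ball x r).
Proof.
rewrite openE => y; rewrite ballEmdist /= => xy.
have e0 : (0 < r - mdist x y)%R by rewrite subr_gt0.
apply: (filterS _ (nbhsx_ballx y _ e0)) => z; rewrite ballEmdist /= => yz.
apply: (le_lt_trans (metric_triangle x y z)); lra.
Qed.

Lemma ler_add_invn (R : archiRealFieldType) (a b : R) :
  (forall n, a <= b + n.+1%:R^-1)%R -> (a <= b)%R.
Proof.
move=> ab; apply/ler_addgt0Pr => e e0.
apply: (le_trans (ab (Num.truncn e^-1))).
by rewrite lerD2l ltW// invf_plt ?posrE// truncnS_gt.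
Qed.

Lemma cball_bigcap (R : realType) (X : pmetricType R) (x : X) (r : R) :
  cball x r = \bigcap_n ball x (r + n.+1%:R^-1).
Proof.
apply/seteqP; split => y /= => [xy n _|xy].
  by rewrite ballEmdist/= (le_lt_trans xy)// ltrDl invr_gt0.
by apply: ler_add_invn => n; have := xy n I; rewrite ballEmdist => /ltW.
Qed.

Lemma measurable_cball (R : realType) (X : pmetricType R) (x : X) (r : R) :
  measurable (cball x r : set (borelType X)).
Proof.
rewrite cball_bigcap; apply: bigcapT_measurable => n.
by apply: sub_sigma_algebra; exact: open_ball_metric.
Qed.

Section metric_measure.
Context (R : realType) (X : pmetricType R).
Variable mu : {measure set (borelType X) -> \bar R}.
Hypothesis hmu : metric_measure mu.

Lemma cball_lty (x : X) (r : R) : mu (cball x r) < +oo.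
Proof.
case: hmu => _ _; apply; first exact: measurable_cball.
exists x, (r + 1)%R => y /= xy.
by rewrite ballEmdist/= (le_lt_trans xy)// ltrDl.
Qed.

Lemma msupport_cball_gt0 (x : X) (r : R) :
  msupport mu x -> (0 < r)%R -> 0 < mu (cball x r).
Proof.
move=> sx r0.
have b0 : 0 < mu (ball x r).
  rewrite lt0e measure_ge0 andbT; apply/eqP => b0; apply: sx.
  exists (ball x r); last exact: ballxx.
  by exists x, r.
apply: lt_le_trans b0 _; apply: le_measure; rewrite ?inE.
- by apply: sub_sigma_algebra; exact: open_ball_metric.
- exact: measurable_cball.
- by move=> y; rewrite ballEmdist => /ltW.
Qed.

(** A closed ball is the intersection of its dilations, so their measures
    decrease to its own, which is strictly below its double. *)
Lemma exists_small_dilation (x : X) (r : R) :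
  (0 < r)%R -> 0 < mu (cball x r) ->
  exists2 T : R, (0 < T < 1)%R & forall t, (0 < t <= T)%R ->
    mu (cball x ((1 + 2 * t) * r)) <= 2%:E * mu (cball x r).
Proof.
move=> r0 B0.
pose F n : set (borelType X) := cball x (r + n.+1%:R^-1).
have Fcap : \bigcap_n F n = cball x r.
  apply/seteqP; split => y /= => [Fy|xy n _]; last first.
    by rewrite /F /cball/= (le_trans xy)// lerDl.
  by apply: ler_add_invn => n; exact: Fy.
have : mu \o F @ \oo --> mu (cball x r).
  rewrite -Fcap; apply: nonincreasing_cvg_mu.
  - exact: cball_lty.
  - by move=> n; exact: measurable_cball.
  - by rewrite Fcap; exact: measurable_cball.
  - move=> m n mn; apply/subsetPset => y /= xy.
    by apply: (le_trans xy); rewrite lerD2l lef_pV2 ?posrE// ler_nat.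
have fB : mu (cball x r) \is a fin_num.
  by rewrite ge0_fin_numE// cball_lty.
have lt2 : mu (cball x r) < 2%:E * mu (cball x r).
  rewrite -(fineK fB) -EFinM lte_fin.
  have : (0 < fine (mu (cball x r)))%R by rewrite fine_gt0// B0 cball_lty.
  by lra.
move=> /(_ _ (open_ereal_lt' lt2)) [n _ /(_ n (leqnn n))/= Fn].
have n0 : (0 < n.+1%:R^-1 / (2 * r) :> R)%R by rewrite divr_gt0// mulr_gt0.
(* With this bound on [t], [(1 + 2 * t) * r <= r + n.+1%:R^-1]. *)
exists (Num.min (2^-1) (n.+1%:R^-1 / (2 * r)))%R.
  by rewrite lt_min gt_min n0 andbT; apply/andP; split; [lra|apply/orP; left; lra].
move=> t /andP[t0]; rewrite le_min => /andP[_ tn].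
apply: le_trans (ltW Fn); apply: le_measure; rewrite ?inE; [exact: measurable_cball..|].
move=> y /= xy; apply: (le_trans xy).
rewrite ler_pdivlMr ?mulr_gt0// in tn.
by rewrite mulrDl mul1r lerD2l; apply: le_trans tn; lra.
Qed.

(** The radius [(1 + t) * r] makes the ball about [y] large enough to contain
    [cball x r], and small enough to have at most twice its measure. *)
Lemma centered_maximal_ge (g : borelType X -> R) (x y : X) (r t : R) :
  measurable_fun setT g ->
  (0 < r)%R -> (0 < t)%R -> 0 < mu (cball x r) ->
  mu (cball x ((1 + 2 * t) * r)) <= 2%:E * mu (cball x r) ->
  cball x (t * r) y ->
  (2%:E * mu (cball x r))^-1 * \int[mu]_(z in cball x r) `|(g z)%:E|
    <= centered_maximal mu g y.
Proof.
move=> mg r0 t0 B0 B2 xy.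
have tr0 : (0 < (1 + t) * r)%R by rewrite mulr_gt0//; lra.
have sub1 : cball x r `<=` cball y ((1 + t) * r).
  move=> z xz; rewrite /cball /= in xy xz *.
  have := metric_triangle y x z; rewrite (metric_sym y x) mulrDl mul1r; lra.
have sub2 : cball y ((1 + t) * r) `<=` cball x ((1 + 2 * t) * r).
  move=> z yz; rewrite /cball /= in xy yz *.
  have := metric_triangle x y z; lra.
have mg' : measurable_fun setT (fun z => `|(g z)%:E|).
  by apply: measurableT_comp => //; apply/measurable_EFinP.
have Ble : mu (cball x r) <= mu (cball y ((1 + t) * r)).
  by apply: le_measure; rewrite ?inE//; exact: measurable_cball.
have yB0 : 0 < mu (cball y ((1 + t) * r)) by exact: lt_le_trans Ble.
apply: (@le_trans _ _ ((mu (cball y ((1 + t) * r)))^-1 *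
    \int[mu]_(z in cball y ((1 + t) * r)) `|(g z)%:E|)); last first.
  by apply: ereal_sup_ubound; exists ((1 + t) * r)%R.
apply: lee_pmul.
- by rewrite inve_ge0 mule_ge0// ltW.
- exact: integral_ge0.
- rewrite lee_pV2 ?inE ?mule_ge0// ?(ltW yB0)//.
  apply: le_trans B2; apply: le_measure; rewrite ?inE//; exact: measurable_cball.
- apply: ge0_subset_integral => //; try exact: measurable_cball.
  exact: measurable_funTS.
Qed.

End metric_measure.

(** * Maximal operator norm *)

(** Every [c] in the set defining [maximal_norm] is above the quotient of the
    two norms, hence so is the infimum. *)
Lemma centered_maximal_le_norm (R : realType) (X : pmetricType R)
    (mu : {measure set (borelType X) -> \bar R}) (q : R) (g : borelType X -> R) :
  g \in Lfun mu q%:E -> 0 < 'N[mu]_q%:E[EFin \o g] ->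
  'N[mu]_q%:E[centered_maximal mu g] <=
    maximal_norm mu q * 'N[mu]_q%:E[EFin \o g].
Proof.
move=> gL; have : 'N[mu]_q%:E[EFin \o g] < +oo.
  by move: (gL); rewrite inE => /andP[_ /[!inE]].
case gE : ('N[mu]_q%:E[EFin \o g]) => [u||]//= _; rewrite lte_fin => u0.
rewrite -lee_pdivrMr//; apply: le_ereal_inf_tmp => c [c0 /(_ g gL)].
by rewrite gE lee_pdivrMr.
Qed.

(** * Comparison of the two sums *)

Theorem theorem3p12 (R : realType) (X : pmetricType R)
    (mu : {measure set (borelType X) -> \bar R}) (hmu : metric_measure mu)
    (p q : R) (hp : (1 < p)%R) (hq : q = (p / (p - 1))%R)
    (N : nat) (x : 'I_N -> X) (r : 'I_N -> R)
    (hr : forall n, (0 < r n)%R) (hx : forall n, msupport mu (x n)) :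
  maximal_norm mu q < +oo ->
  exists T : 'I_N -> R,
    (forall n, (0 < T n < 1)%R) /\
    forall t : 'I_N -> R, (forall n, (0 < t n <= T n)%R) ->
    forall w : 'I_N -> R, (forall n, (0 < w n)%R) ->
      'N[mu]_p%:E[(fun y => \sum_(n < N)
          (w n * \1_(cball (x n) (r n)) y)%:E / mu (cball (x n) (r n)))]
      <= 2%:E * maximal_norm mu q *
         'N[mu]_p%:E[(fun y => \sum_(n < N)
            (w n * \1_(cball (x n) (t n * r n)) y)%:E
              / mu (cball (x n) (t n * r n)))].
Proof.
move=> _.
have cball_pos s n : (0 < s)%R -> 0 < mu (cball (x n) s) < +oo.
  by move=> s0; rewrite msupport_cball_gt0//= cball_lty.
have /choice[T HT] n : exists T : R, (0 < T < 1)%R /\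
    forall t, (0 < t <= T)%R ->
      mu (cball (x n) ((1 + 2 * t) * r n)) <= 2%:E * mu (cball (x n) (r n)).
  have /andP[B0 _] := cball_pos _ n (hr n).
  by have [T T01 HT] := exists_small_dilation hmu (hr n) B0; exists T.
exists T; split=> [n|t tT w w_gt0]; first by case: (HT n).
have w0 n : (0 <= w n)%R by exact: ltW.
have tr n : (0 < t n * r n)%R by case/andP: (tT n) => t0 _; rewrite mulr_gt0.
pose B n : set (borelType X) := cball (x n) (r n).
pose b n : set (borelType X) := cball (x n) (t n * r n).
have mB n : measurable (B n) by exact: measurable_cball.
have mb n : measurable (b n) by exact: measurable_cball.
have B0 n : 0 < mu (B n) < +oo by exact: cball_pos.
have b0 n : 0 < mu (b n) < +oo by exact: cball_pos.
have normE (A : 'I_N -> set (borelType X)) : (forall n, 0 < mu (A n) < +oo) ->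
    'N[mu]_p%:E[(fun y => \sum_(n < N) (w n * \1_(A n) y)%:E / mu (A n))] =
    'N[mu]_p%:E[EFin \o normalized_sum mu w A].
  by move=> A0; apply: eq_Lnorm => y; rewrite -normalized_sumE.
rewrite (normE B B0) (normE b b0).
pose F := normalized_sum mu w B.
have F0 y : (0 <= F y)%R by exact: normalized_sum_ge0.
have FL : F \in Lfun mu p%:E by apply: Lfun_normalized_sum => //; exact: ltW.
have M0 : 0 <= maximal_norm mu q by apply: le_ereal_inf_tmp => c [].
apply: (Lnorm_le_dual hp hq F0 FL).
  by apply: mule_ge0; [exact: mule_ge0 | exact: Lnorm_ge0].
move=> g gpos.
have g0 y : (0 <= g y)%R by exact: powR_ge0.
have gL : g \in Lfun mu q%:E by exact: Lfun_powR_conj.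
have mg : measurable_fun setT g by move: gL; rewrite inE => /andP[/[!inE]].
rewrite integral_normalized_sum//.
(* The factor 2 is the price for replacing [B n] by a larger ball about a
   point of [b n]. *)
pose c n := fine ((2%:E * mu (B n))^-1 * \int[mu]_(y in B n) (g y)%:E).
have finB n : mu (B n) = (fine (mu (B n)))%:E.
  by rewrite fineK// ge0_fin_numE//; case/andP: (B0 n).
have fB0 n : (0 < fine (mu (B n)))%R by exact: fine_gt0.
(* [g] is bounded, because [F] is. *)
have finI n : \int[mu]_(y in B n) (g y)%:E =
    (fine (\int[mu]_(y in B n) (g y)%:E))%:E.
  rewrite fineK// ge0_fin_numE ?integral_ge0//; last first.
    by move=> y _; rewrite lee_fin.
  apply: (bounded_integral_lty
    (C := (\sum_(n < N) w n / fine (mu (B n))) `^ (p - 1))%R) => //.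
    by case/andP: (B0 n).
  move=> y; rewrite g0/=; apply: ge0_ler_powR; rewrite ?nnegrE//; first lra.
    by apply: sumr_ge0 => k _; rewrite divr_ge0// ltW.
  exact: normalized_sum_le.
have cE n : (c n)%:E = (2%:E * mu (B n))^-1 * \int[mu]_(y in B n) (g y)%:E.
  by rewrite /c finI finB -EFinM inver gt_eqF// mulr_gt0.
have c0 n : (0 <= c n)%R.
  rewrite fine_ge0// mule_ge0 ?inve_ge0 ?mule_ge0// integral_ge0//.
  by move=> y _; rewrite lee_fin.
rewrite (_ : \sum_(n < N) _ = 2%:E * (\sum_(n < N) w n * c n)%:E); last first.
  rewrite -EFinM mulr_sumr -sumEFin; apply: eq_bigr => n _.
  rewrite mulrCA EFinM (EFinM 2) cE; congr (_ * _).
  rewrite finI finB -EFinM !inver !gt_eqF ?mulr_gt0// -!EFinM.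
  by congr (_%:E); field; rewrite gt_eqF.
rewrite -!muleA; apply: lee_wpmul2l => //.
apply: le_trans (weighted_sum_le_Lnorm w0 mb b0 hp hq c0 _) _.
  move=> n y by_; rewrite cE.
  under eq_integral do rewrite -[(g _)%:E]gee0_abs ?lee_fin//.
  case: (HT n) => _ /(_ _ (tT n)) B2; case/andP: (tT n) => t0 _.
  apply: (centered_maximal_ge mg (hr n) t0) => //.
    by case/andP: (B0 n).
  exact: by_.
rewrite [leRHS]muleCA [leRHS]muleC; apply: lee_wpmul2r; first exact: Lnorm_ge0.
exact: centered_maximal_le_norm.
Qed.
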